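(* Let $w\colon(0,\infty)\to[0,\infty)$ be a measurable weight that is positive almost everywhere, and let $H_w'$ be the associated weighted Laplace dual space. Assume that $w$ is such that $\mu,\mu_h\in H_w'$, where $\mu=\sum_{k=1}^\infty\delta_{\lambda_k}$ and $\mu_h=\sum_{k=1}^{N_h}\delta_{\lambda_{k,h}}$ are the continuous and discrete spectral measures, and that the discrete and continuous eigenvalues satisfy the Rayleigh--Ritz monotonicity principle $\lambda_k\le\lambda_{k,h}$ for every $k=1,\dots,N_h$. Then $$\|\mu_h\|_{H_w'}\le\|\mu\|_{H_w'}.$$
   Context: Let $\Omega\subset\mathbb{R}^d$ be a bounded connected domain with Lipschitz boundary. $0<\lambda_1<\lambda_2\le\lambda_3\le\cdots\to\infty$ are the eigenvalues, counted with multiplicity, of the Dirichlet Laplacian: $-\Delta u_k=\lambda_k u_k$ in $\Omega$, $u_k=0$ on $\partial\Omega$. $V_h\subset H_0^1(\Omega)$ is a conforming finite element space of finite dimension $N_h$, and $0<\lambda_{1,h}\le\cdots\le\lambda_{N_h,h}$ are the discrete eigenvalues, counted with multiplicity: $\int_\Omega\nabla u_{k,h}\cdot\nabla v_h\,dx=\lambda_{k,h}\int_\Omega u_{k,h}v_h\,dx$ for all $v_h\in V_h$. For a weight $w$ such that $t\mapsto\sqrt{w(t)}\,e^{-\lambda t}$ lies in $L^2(0,\infty)$ for every $\lambda>0$, the weighted Laplace space $H_w$ is the reproducing kernel Hilbert space on $(0,\infty)$ with kernel $K(\lambda,\eta)=\int_0^\infty e^{-(\lambda+\eta)t}w(t)\,dt$,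 and $H_w'$ is its dual, realized on measures with inner product $\langle\mu,\nu\rangle_{H_w'}=\int_0^\infty \mathcal{L}[\mu](t)\,\mathcal{L}[\nu](t)\,w(t)\,dt$, where $\mathcal{L}[\mu](t)=\int_0^\infty e^{-\lambda t}\,d\mu(\lambda)$. For the spectral measures, with heat traces $Z(t)=\sum_{k=1}^\infty e^{-\lambda_k t}=\mathcal{L}[\mu](t)$ and $Z_h(t)=\sum_{k=1}^{N_h}e^{-\lambda_{k,h}t}=\mathcal{L}[\mu_h](t)$, membership $\mu\in H_w'$ means $\int_0^\infty Z(t)^2w(t)\,dt<\infty$ (and likewise for $\mu_h$ with $Z_h$), and $$\|\mu\|_{H_w'}^2=\int_0^\infty Z(t)^2w(t)\,dt,\qquad \|\mu_h\|_{H_w'}^2=\int_0^\infty Z_h(t)^2w(t)\,dt.$$ *)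

(* Defs.v *)
From HB Require Import structures.
From mathcomp Require Import all_boot all_order all_algebra.
From mathcomp Require Import all_classical all_reals all_analysis.
From mathcomp Require Import measurable_realfun.

Set Implicit Arguments.
Unset Strict Implicit.
Unset Printing Implicit Defensive.

Import Order.TTheory GRing.Theory Num.Theory.
Import numFieldNormedType.Exports.

Local Open Scope classical_set_scope.
Local Open Scope ring_scope.

(* The sigma-algebra on row vectors generated by the coordinates (equivalently,
   the Borel sigma-algebra), and the d-dimensional Lebesgue measure. *)

Definition rV_display : measure_display. Proof. exact: default_measure_display. Qed.

Section measurable_rV.
Context {R : realType} (n : nat).

Let coord (i : 'I_n) (x : 'rV[R]_n) : measurableTypeR R := x ord0 i.

Let rV_set0 : g_sigma_preimage coord set0.
Proof. exact: sigma_algebra0. Qed.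

Let rV_setC A : g_sigma_preimage coord A -> g_sigma_preimage coord (~` A).
Proof. exact: sigma_algebraC. Qed.

Let rV_bigcup (F : (set 'rV[R]_n)^nat) :
  (forall i, g_sigma_preimage coord (F i)) ->
  g_sigma_preimage coord (\bigcup_i (F i)).
Proof. exact: sigma_algebra_bigcup. Qed.

HB.instance Definition _ := @isMeasurable.Build rV_display
  'rV[R]_n (g_sigma_preimage coord) rV_set0 rV_setC rV_bigcup.

End measurable_rV.

Lemma measurable_rV_coord (R : realType) n (i : 'I_n) :
  measurable_fun [set: 'rV[R]_n] (fun x => x ord0 i : measurableTypeR R).
Proof.
move=> _ Y mY; rewrite setTI; apply: sub_sigma_algebra => /=.
rewrite -bigcup_seq/=; exists i => /=; first by rewrite mem_index_enum.
by exists Y => //; rewrite setTI.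
Qed.

Lemma measurable_fun_rV d (T : measurableType d) (R : realType) n
    (f : T -> 'rV[R]_n) :
  (forall i, measurable_fun [set: T] (fun x => f x ord0 i : measurableTypeR R)) ->
  measurable_fun [set: T] f.
Proof.
move=> mf.
suff : preimage_set_system setT f measurable `<=` measurable.
  by move=> h _ A mA; apply: h; exists A.
have <- : g_sigma_preimage (fun i x => f x ord0 i : measurableTypeR R) =
    preimage_set_system [set: T] f measurable.
  exact: (@g_sigma_preimage_comp _ _ n _
    (fun i (x : 'rV[R]_n) => x ord0 i : measurableTypeR R) _ f).
apply: smallest_sub; first exact: sigma_algebra_measurable.
rewrite -bigcup_seq => A [i _ [B mB <-]]; exact: mf.
Qed.

Section lebesgue_rV.
Context {R : realType}.

Definition rV_cons n (p : measurableTypeR R * 'rV[R]_n) : 'rV[R]_n.+1 :=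
  \row_i (if unlift ord0 i is Some j then p.2 ord0 j else p.1).

Definition rV_uncons n (x : 'rV[R]_n.+1) : measurableTypeR R * 'rV[R]_n :=
  (x ord0 ord0, \row_j x ord0 (lift ord0 j)).

Lemma rV_consK n : cancel (@rV_cons n) (@rV_uncons n).
Proof.
move=> [a y]; rewrite /rV_uncons /rV_cons mxE unlift_none/=; congr (_, _).
by apply/rowP => j; rewrite !mxE liftK.
Qed.

Lemma rV_unconsK n : cancel (@rV_uncons n) (@rV_cons n).
Proof.
move=> x; apply/rowP => i; rewrite mxE /=.
by case: unliftP => [j ->|->//]; rewrite mxE.
Qed.

Lemma measurable_rV_cons n : measurable_fun setT (@rV_cons n).
Proof.
apply: measurable_fun_rV => i; case: (unliftP ord0 i) => [j ->|->].
  under eq_fun do rewrite mxE liftK.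
  apply: (@measurableT_comp _ _ _ _ _ _ (fun x : 'rV[R]_n => x ord0 j : measurableTypeR R)).
    exact: measurable_rV_coord.
  exact: measurable_snd.
under eq_fun do rewrite mxE unlift_none.
exact: measurable_fst.
Qed.

Lemma measurable_rV_uncons n : measurable_fun setT (@rV_uncons n).
Proof.
apply/measurable_fun_pairP; split; first exact: measurable_rV_coord.
apply: measurable_fun_rV => i; rewrite /rV_uncons/=.
under eq_fun do rewrite mxE.
exact: measurable_rV_coord.
Qed.

Section step.
Variables (n : nat) (m : {sigma_finite_measure set 'rV[R]_n -> \bar R}).

Definition lebesgue_cons : set 'rV[R]_n.+1 -> \bar R :=
  pushforward ((@lebesgue_measure R) \x m)%E (@rV_cons n).

Let m0 : lebesgue_cons set0 = 0%E.
Proof. by rewrite /lebesgue_cons /pushforward preimage_set0 measure0. Qed.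

Let m_ge0 A : (0 <= lebesgue_cons A)%E.
Proof. exact: (measure_ge0 ((@lebesgue_measure R) \x m)%E). Qed.

Let m_sigma_additive : semi_sigma_additive lebesgue_cons.
Proof.
move=> F mF tF mUF; rewrite /lebesgue_cons /pushforward preimage_bigcup.
apply: measure_semi_sigma_additive.
- by move=> k; rewrite -[X in measurable X]setTI; exact: measurable_rV_cons.
- apply/trivIsetP => /= i j _ _ ij; rewrite -preimage_setI.
  by move/trivIsetP : tF => /(_ _ _ _ _ ij) ->//; rewrite preimage_set0.
- rewrite -preimage_bigcup -[X in measurable X]setTI.
  exact: measurable_rV_cons.
Qed.

HB.instance Definition _ := isMeasure.Build _ _ _
  lebesgue_cons m0 m_ge0 m_sigma_additive.

Let m_sigma_finite : sigma_finite setT lebesgue_cons.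
Proof.
have [F FT Foo] := sigma_finiteT (@lebesgue_measure R).
have [G GT Goo] := sigma_finiteT m.
pose f := fun k => if unpickle k is Some (i, j) then F i `*` G j else set0.
have mf k : measurable (f k) /\ (((@lebesgue_measure R) \x m) (f k) < +oo)%E.
  rewrite /f; case: unpickle => [[i j]|]; last first.
    by split; [exact: measurable0|rewrite measure0].
  have [mF Fi] := Foo i; have [mG Gj] := Goo j.
  split; first exact: measurableX.
  by rewrite product_measure1E// lte_mul_pinfty// ge0_fin_numE.
exists (fun k => @rV_uncons n @^-1` f k).
  rewrite -preimage_bigcup (_ : \bigcup_i f i = setT) ?preimage_setT//.
  rewrite -subTset => -[a y] _.
  have [i _ Fa] : (\bigcup_i F i) a by rewrite -FT.
  have [j _ Gy] : (\bigcup_i G i) y by rewrite -GT.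
  by exists (pickle (i, j)) => //; rewrite /f pickleK.
move=> k; have [mfk fk] := mf k; split.
  by rewrite -[X in measurable X]setTI; exact: measurable_rV_uncons.
rewrite /lebesgue_cons /pushforward -comp_preimage.
rewrite (_ : _ @^-1` _ = f k)//; apply/seteqP; split=> p /=;
  by rewrite rV_consK.
Qed.

HB.instance Definition _ := Measure_isSigmaFinite.Build _ _ _
  lebesgue_cons m_sigma_finite.

End step.

Fixpoint lebesgue_rV n : {sigma_finite_measure set 'rV[R]_n -> \bar R} :=
  if n is k.+1 then lebesgue_cons (lebesgue_rV k)
  else \d_(0 : 'rV[R]_0).

End lebesgue_rV.

Lemma lebesgue_rV_box (R : realType) n (A : 'I_n -> set (measurableTypeR R)) :
  (forall i, measurable (A i)) ->
  lebesgue_rV n [set x | forall i, A i (x ord0 i)] =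
  (\prod_(i < n) (@lebesgue_measure R) (A i))%E.
Proof.
elim: n A => [|n ih] A mA.
  rewrite big_ord0 /= diracE mem_set//; by case.
rewrite big_ord_recl -ih//=.
have mB : measurable [set x : 'rV[R]_n | forall i, A (lift ord0 i) (x ord0 i)].
  rewrite (_ : mkset _ = \bigcap_(i in [set: 'I_n])
     (fun x : 'rV[R]_n => x ord0 i : measurableTypeR R) @^-1` (A (lift ord0 i))).
    apply: fin_bigcap_measurable => // i _.
    by rewrite -[X in measurable X]setTI; exact: measurable_rV_coord.
  by apply/seteqP; split=> [x h i _|x h i]; [exact: h|exact: (h i)].
rewrite -product_measure1E// /lebesgue_cons /pushforward; congr (product_measure1 _ _ _).
apply/seteqP; split=> [p /= h|p /= [h1 h2] i].
  split=> [|i]; first by have := h ord0; rewrite mxE unlift_none.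
  by have := h (lift ord0 i); rewrite mxE liftK.
by rewrite mxE; case: unliftP => [j ->|->//].
Qed.

Definition square_integrable d (T : measurableType d) (R : realType)
    (mu : {measure set T -> \bar R}) (D : set T) (f : T -> R) : Prop :=
  measurable_fun D f /\ (\int[mu]_(x in D) ((f x) ^+ 2)%:E < +oo)%E.

Section domain.
Context {R : realType} {n : nat}.
Implicit Type Omega : set 'rV[R]_n.+1.

(* Near each boundary point, after an orthogonal change of coordinates
   y = x Q, Omega is the strict epigraph of a Lipschitz function g of the
   remaining n coordinates. (The library norm on row vectors is the sup norm,
   which yields the same Lipschitz functions as the Euclidean norm.) *)
Definition lipschitz_boundary Omega : Prop :=
  forall p, (closure Omega `\` interior Omega) p ->
  exists (Q : 'M[R]_n.+1) (g : 'rV[R]_n -> R),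
    [/\ Q *m Q^T = 1%:M,
        [lipschitz g z | z in [set: 'rV[R]_n]] &
        \forall x \near p,
          Omega x <-> g (rV_uncons (x *m Q)).2 < (rV_uncons (x *m Q)).1].

Definition lipschitz_domain Omega : Prop :=
  [/\ open Omega, Omega !=set0, connected Omega, bounded_set Omega &
      lipschitz_boundary Omega].

End domain.

Section sobolev.
Context {R : realType} {n : nat}.
Local Notation E := 'rV[R]_n.
Implicit Types (Omega : set E) (u v phi : E -> R) (V W : set (E -> R)).

Definition partial (i : 'I_n) (f : E -> R) : E -> R :=
  'D_(delta_mx ord0 i) f.

Definition iter_partial (s : seq 'I_n) (f : E -> R) : E -> R :=
  foldr partial f s.

Definition smooth (f : E -> R) : Prop :=
  forall s : seq 'I_n, continuous (iter_partial s f) /\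
    forall (i : 'I_n) (x : E), derivable (iter_partial s f) x (delta_mx ord0 i).

Definition test_function Omega phi : Prop :=
  smooth phi /\
  exists K, [/\ compact K, K `<=` Omega & forall x, ~ K x -> phi x = 0].

Definition weak_gradient Omega u (G : 'I_n -> E -> R) : Prop :=
  forall i, square_integrable (lebesgue_rV n) Omega (G i) /\
    forall phi, test_function Omega phi ->
      \int[lebesgue_rV n]_(x in Omega) (u x * partial i phi x) =
      - \int[lebesgue_rV n]_(x in Omega) (G i x * phi x).

Definition sobolev_H1 Omega u : Prop :=
  square_integrable (lebesgue_rV n) Omega u /\ exists G, weak_gradient Omega u G.

(* For u in H^1 this is a representative of the weak gradient, which is unique
   almost everywhere; outside H^1 the value is irrelevant. *)
Definition grad Omega u : 'I_n -> E -> R :=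
  xget (fun _ _ => 0) [set G | weak_gradient Omega u G].

Definition L2_inner Omega u v : R :=
  \int[lebesgue_rV n]_(x in Omega) (u x * v x).

Definition dirichlet_form Omega u v : R :=
  \int[lebesgue_rV n]_(x in Omega)
    (\sum_(i < n) grad Omega u i x * grad Omega v i x).

Definition sobolev_H1_norm Omega u : R :=
  Num.sqrt (L2_inner Omega u u + dirichlet_form Omega u u).

(* The closure in H^1 of the smooth functions compactly supported in Omega. *)
Definition sobolev_H10 Omega : set (E -> R) :=
  [set u | sobolev_H1 Omega u /\
    forall e : R, 0 < e -> exists2 phi, test_function Omega phi &
      sobolev_H1_norm Omega (fun x => u x - phi x) < e].

(* Dimension of a linear space of functions, modulo equality almost everywhere
   on Omega. *)
Definition has_dimension Omega W (m : nat) : Prop :=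
  exists b : 'I_m -> E -> R,
    [/\ forall i, W (b i),
        forall c : 'I_m -> R,
          {ae lebesgue_rV n, forall x, Omega x -> \sum_(i < m) c i * b i x = 0} ->
          forall i, c i = 0 &
        forall u, W u -> exists c : 'I_m -> R,
          {ae lebesgue_rV n,
            forall x, Omega x -> u x = \sum_(i < m) c i * b i x}].

Definition conforming_space Omega V (N : nat) : Prop :=
  [/\ V `<=` sobolev_H10 Omega,
      V (fun=> 0),
      forall (a : R) u v, V u -> V v -> V (fun x => a * u x + v x) &
      has_dimension Omega V N].

(* With V := sobolev_H10 Omega this is the weak form of - Delta u = L u in
   Omega, u = 0 on the boundary; with V a finite element space it is the
   Galerkin eigenproblem. *)
Definition eigenspace_in Omega V (L : R) : set (E -> R) :=
  [set u | V u /\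
    forall v, V v -> dirichlet_form Omega u v = L * L2_inner Omega u v].

(* The eigenvalues in V, counted with multiplicity, are the lam k, k in D:
   each real L occurs as many times as the dimension of its eigenspace (zero
   times if L is not an eigenvalue). *)
Definition lists_eigenvalues Omega V (D : set nat) (lam : nat -> R) : Prop :=
  forall L : R, exists m : nat,
    ([set k | D k /\ lam k = L] #= `I_m)%card /\
    has_dimension Omega (eigenspace_in Omega V L) m.

(* Indices start at 0: lam k and lamh k are the (k+1)-st eigenvalues. *)
Definition dirichlet_spectrum Omega (lam : nat -> R) : Prop :=
  [/\ 0 < lam 0%N, lam 0%N < lam 1%N,
      forall j k, (j <= k)%N -> lam j <= lam k,
      lam k @[k --> \oo] --> +oo &
      lists_eigenvalues Omega (sobolev_H10 Omega) setT lam].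

(* Only the values lamh k with k < N are constrained. *)
Definition discrete_spectrum Omega V (N : nat) (lamh : nat -> R) : Prop :=
  [/\ forall k, (k < N)%N -> 0 < lamh k,
      forall j k, (j <= k < N)%N -> lamh j <= lamh k &
      lists_eigenvalues Omega V `I_N lamh].

End sobolev.

Section laplace.
Context {R : realType}.
Local Notation leb := (@lebesgue_measure R).
Implicit Types (w : R -> R) (mu nu : {measure set (measurableTypeR R) -> \bar R}).

Definition half_line : set (measurableTypeR R) := `](0 : R), +oo[%classic.

Definition laplace_transform mu (t : R) : \bar R :=
  (\int[mu]_(l in half_line) (expR (- (l * t)))%:E)%E.

(* A weight for which the weighted Laplace space is defined. *)
Definition laplace_weight w : Prop :=
  [/\ measurable_fun half_line w,
      forall t, 0 < t -> 0 <= w t &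
      forall l, 0 < l ->
        square_integrable leb half_line
          (fun t => Num.sqrt (w t) * expR (- (l * t)))].

(* The reproducing kernel of the weighted Laplace space. *)
Definition laplace_kernel w (l e : R) : \bar R :=
  (\int[leb]_(t in half_line) (expR (- ((l + e) * t)) * w t)%:E)%E.

(* The inner product of the dual space, realized on measures; on point masses
   it is the reproducing kernel, see laplace_dual_inner_dirac. *)
Definition laplace_dual_inner w mu nu : \bar R :=
  (\int[leb]_(t in half_line)
     (laplace_transform mu t * laplace_transform nu t * (w t)%:E))%E.

Lemma laplace_transform_dirac (l t : R) : 0 < l ->
  laplace_transform (\d_(l : measurableTypeR R)) t = (expR (- (l * t)))%:E.
Proof.
move=> l0; rewrite /laplace_transform integral_dirac//=.
- by rewrite diracE mem_set ?mul1e//= /half_line/= in_itv/= l0.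
- exact: measurable_itv.
- apply/measurable_EFinP; apply: measurableT_comp => //.
  by apply: measurableT_comp => //; exact: measurable_funM.
Qed.

Lemma laplace_dual_inner_dirac w (l e : R) : 0 < l -> 0 < e ->
  laplace_dual_inner w (\d_(l : measurableTypeR R)) (\d_(e : measurableTypeR R)) =
  laplace_kernel w l e.
Proof.
move=> l0 e0; apply: eq_integral => t _.
by rewrite !laplace_transform_dirac// -!EFinM -expRD mulrDl opprD.
Qed.

Definition laplace_dual w mu : Prop := (laplace_dual_inner w mu mu < +oo)%E.

Definition laplace_dual_norm w mu : R :=
  Num.sqrt (fine (laplace_dual_inner w mu mu)).

Definition spectral_measure (lam : nat -> R) :
    {measure set (measurableTypeR R) -> \bar R} :=
  mseries (fun k => \d_(lam k : measurableTypeR R)) 0.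

Definition discrete_spectral_measure (N : nat) (lamh : nat -> R) :
    {measure set (measurableTypeR R) -> \bar R} :=
  msum (fun k => \d_(lamh k : measurableTypeR R)) N.

End laplace.

(* Main.v *)
Require Import Defs.
From HB Require Import structures.
From mathcomp Require Import all_boot all_order all_algebra.
From mathcomp Require Import all_classical all_reals all_analysis.
From mathcomp Require Import measurable_realfun.
Import Order.TTheory GRing.Theory Num.Theory.
Import numFieldNormedType.Exports.
Local Open Scope classical_set_scope.
Local Open Scope ring_scope.

(** The squared norm of a measure in the dual space is the integral over
    [0 < t] of the square of its Laplace transform against [w].  For a sum of
    point masses at positive points the transform is a heat trace, a sum of
    the exponentials [expR (- (lam k * t))].  For [t > 0] each of them decreases in
    [lam k], so the inequalities [lam k <= lamh k] give
    [expR (- (lamh k * t)) <= expR (- (lam k * t))] term by term, and the terms of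
    index [k >= N] only enlarge the continuous trace.  Hence the discrete trace
    lies below the continuous one at every [t > 0]
    ([laplace_transform_spectral_le]), and squaring and integrating against
    the nonnegative weight keeps the order ([le_laplace_dual_norm]). *)

(** The integral of a nonnegative function is the supremum of the integrals of
    the simple functions below it, and a larger function has more of these.
    This form lets Laplace transforms of arbitrary measures be compared under
    the integral without studying their dependence on [t]. *)
Lemma ge0_le_integral_nonmeasurable (disp : measure_display)
    (T : measurableType disp) (R : realType) (mu : {measure set T -> \bar R})
    (D : set T) (f g : T -> \bar R) :
  (forall x, D x -> (0 <= f x)%E) -> (forall x, D x -> (f x <= g x)%E) ->
  (\int[mu]_(x in D) f x <= \int[mu]_(x in D) g x)%E.
Proof.
move=> f0 fg; have g0 x : D x -> (0 <= g x)%E.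
  by move=> Dx; apply: le_trans (f0 x Dx) (fg x Dx).
rewrite !ge0_integralE//; apply: ereal_sup_le => _ [h hf <-].
exists h => // x.
exact: le_trans (hf x) (lee_restrict fg x).
Qed.

Section heat_trace.
Context {R : realType}.
Implicit Types (lam lamh : nat -> R) (w : R -> R).
Implicit Types (mu nu : {measure set (measurableTypeR R) -> \bar R}).

Lemma laplace_transform_ge0 mu (t : R) : (0 <= laplace_transform mu t)%E.
Proof. by apply: integral_ge0 => l _; rewrite lee_fin expR_ge0. Qed.

Lemma measurable_half_line : measurable (@half_line R).
Proof. exact: measurable_itv. Qed.

Lemma measurable_laplace_exp (D : set (measurableTypeR R)) (t : R) :
  measurable_fun D (fun l : measurableTypeR R => (expR (- (l * t)))%:E).
Proof.
apply/measurable_EFinP; apply: measurableT_comp => //.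
by apply: measurableT_comp => //; exact: measurable_funM.
Qed.

(** The positivity of the points matters: the transform integrates over the
    open half line only, and does not see masses outside it. *)
Lemma laplace_transform_spectral lam (t : R) : (forall k, 0 < lam k) ->
  laplace_transform (spectral_measure lam) t =
  (\sum_(k <oo) (expR (- (lam k * t)))%:E)%E.
Proof.
move=> lam0; rewrite /laplace_transform /spectral_measure.
rewrite ge0_integral_measure_series//.
- by apply: eq_eseriesr => k _; exact: laplace_transform_dirac.
- exact: measurable_half_line.
- exact: measurable_laplace_exp.
Qed.

Lemma laplace_transform_discrete (N : nat) lamh (t : R) :
  (forall k, (k < N)%N -> 0 < lamh k) ->
  laplace_transform (discrete_spectral_measure N lamh) t =
  (\sum_(k < N) (expR (- (lamh k * t)))%:E)%E.
Proof.
move=> lamh0; rewrite /laplace_transform /discrete_spectral_measure.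
rewrite ge0_integral_measure_sum//.
- by apply: eq_bigr => k _; apply: laplace_transform_dirac; exact: lamh0.
- exact: measurable_half_line.
- exact: measurable_laplace_exp.
Qed.

(** Each exponential decreases when its point is raised, and the partial sums
    of a series of nonnegative terms lie below the series. *)
Lemma laplace_transform_spectral_le (N : nat) lam lamh (t : R) :
  (forall k, 0 < lam k) -> (forall k, (k < N)%N -> lam k <= lamh k) ->
  0 <= t ->
  (laplace_transform (discrete_spectral_measure N lamh) t <=
   laplace_transform (spectral_measure lam) t)%E.
Proof.
move=> lam0 le_lam t0.
rewrite laplace_transform_spectral// laplace_transform_discrete; last first.
  by move=> k kN; apply: lt_le_trans (lam0 k) _; exact: le_lam.
apply: (@le_trans _ _ (\sum_(0 <= k < N) (expR (- (lam k * t)))%:E)%E).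
  rewrite big_mkord; apply: lee_sum => k _.
  by rewrite lee_fin ler_expR lerN2 ler_wpM2r// le_lam.
by apply: nneseries_lim_ge => k _ _; rewrite lee_fin expR_ge0.
Qed.

(** The finiteness of the larger norm cannot be dropped: the norm is a square
    root of [fine], which sends [+oo] to [0]. *)
Lemma le_laplace_dual_norm w mu nu :
  (forall t, 0 < t -> 0 <= w t) ->
  (forall t, 0 < t -> (laplace_transform mu t <= laplace_transform nu t)%E) ->
  laplace_dual w nu ->
  laplace_dual_norm w mu <= laplace_dual_norm w nu.
Proof.
move=> w0 le_mu_nu nu_fin.
have half_gt0 (t : R) : half_line t -> 0 < t.
  by rewrite /half_line /= in_itv/= andbT.
have inner_ge0 m : (0 <= laplace_dual_inner w m m)%E.
  apply: integral_ge0 => t /half_gt0 t0.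
  by rewrite !mule_ge0 ?laplace_transform_ge0// lee_fin w0.
have inner_le : (laplace_dual_inner w mu mu <= laplace_dual_inner w nu nu)%E.
  apply: ge0_le_integral_nonmeasurable => t /half_gt0 t0.
    by rewrite !mule_ge0 ?laplace_transform_ge0// lee_fin w0.
  apply: lee_wpmul2r; first by rewrite lee_fin w0.
  by apply: lee_pmul; rewrite ?laplace_transform_ge0// le_mu_nu.
rewrite /laplace_dual_norm; apply: ler_wsqrtr; apply: fine_le => //.
  by rewrite ge0_fin_numE//; exact: le_lt_trans nu_fin.
by rewrite ge0_fin_numE.
Qed.

End heat_trace.

Theorem theorem4p1 (R : realType) (d : nat) (Omega : set 'rV[R]_d.+1)
  (lam : nat -> R)
  (Vh : set ('rV[R]_d.+1 -> R)) (N : nat) (lamh : nat -> R)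
  (w : R -> R)
  (hOmega : lipschitz_domain Omega)
  (hlam : dirichlet_spectrum Omega lam)
  (hVh : conforming_space Omega Vh N)
  (hlamh : discrete_spectrum Omega Vh N lamh)
  (hw : laplace_weight w)
  (hw_pos : {ae @lebesgue_measure R, forall t, 0 < t -> 0 < w t})
  (hmu : laplace_dual w (spectral_measure lam))
  (hmuh : laplace_dual w (discrete_spectral_measure N lamh))
  (hRR : forall k, (k < N)%N -> lam k <= lamh k) :
  laplace_dual_norm w (discrete_spectral_measure N lamh) <=
  laplace_dual_norm w (spectral_measure lam).
Proof.
have [lam0_gt0 _ lam_mono _ _] := hlam.
have lam_gt0 k : 0 < lam k by apply: lt_le_trans lam0_gt0 _; exact: lam_mono.
have [_ w_ge0 _] := hw.
apply: le_laplace_dual_norm => // t t0.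
by apply: laplace_transform_spectral_le => //; exact: ltW.
Qed.
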